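(* Let $T$ be a string of length $n$ over an alphabet $\Sigma$ of size $\sigma\ge 2$. For any $1<i\le j\le n$, $|\mathsf{MUS}(T[i-1..j])\bigtriangleup\mathsf{MUS}(T[i..j])|\le 4$ and $-1\le|\mathsf{MUS}(T[i-1..j])|-|\mathsf{MUS}(T[i..j])|\le 2$. Furthermore, these bounds are tight: for any $\sigma\ge 3$ and any $i,j$ with $1<i\le j\le n$ and $j-i+1\ge 5$, there exist strings $T$ over an alphabet of size $\sigma$ attaining $|\mathsf{MUS}(T[i-1..j])\bigtriangleup\mathsf{MUS}(T[i..j])|=4$, strings attaining $|\mathsf{MUS}(T[i-1..j])|-|\mathsf{MUS}(T[i..j])|=2$, and strings attaining $|\mathsf{MUS}(T[i-1..j])|-|\mathsf{MUS}(T[i..j])|=-1$.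
   Context: $T[a..b]$ denotes the substring of $T$ from position $a$ to $b$. For a string $S$ and a string $w$, $\#\mathit{occ}_S(w)$ is the number of positions at which $w$ occurs in $S$; by convention $\#\mathit{occ}_S(\varepsilon)=|S|+1$. A substring $w$ of $S$ is unique in $S$ if $\#\mathit{occ}_S(w)=1$ and repeating in $S$ if $\#\mathit{occ}_S(w)\ge 2$. For $1\le i\le j\le n$, $\mathsf{MUS}(T[i..j])$ is the set of intervals $[s,t]$ (positions in $T$) with $i\le s\le t\le j$ such that $T[s..t]$ is unique in $T[i..j]$ and every proper substring of $T[s..t]$ (including the empty string) is repeating in $T[i..j]$. $\bigtriangleup$ denotes symmetric difference. *)

(* Defs.v *)
From mathcomp Require Import all_boot all_order all_algebra.
Set Implicit Arguments. Unset Strict Implicit. Unset Printing Implicit Defensive.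

Section Strings.
Variable A : eqType.

(* T[a..b] with 1-indexed positions (for 1 <= a <= b+1) *)
Definition substr (T : seq A) (a b : nat) : seq A := take (b.+1 - a) (drop a.-1 T).

(* #occ_S(w); by convention #occ_S(eps) = |S| + 1 *)
Definition occ (S w : seq A) : nat :=
  if w is [::] then (size S).+1
  else count (fun p => take (size w) (drop p S) == w) (iota 0 (size S)).

Definition uniqueb (S w : seq A) : bool := occ S w == 1.
Definition repeatingb (S w : seq A) : bool := 2 <= occ S w.

(* every proper substring u of w (including the empty string) is repeating in S;
   the substrings of w are exactly w[a..b) = take (b-a) (drop a w), 0 <= a <= b <= |w|,
   proper iff b - a < |w| *)
Definition proper_subs_repeating (S w : seq A) : bool :=
  [forall a : 'I_(size w).+1, forall b : 'I_(size w).+1,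
     ((a <= b) && (b - a < size w)) ==> repeatingb S (take (b - a) (drop a w))].

Definition is_mus (T : seq A) (i j s t : nat) : bool :=
  [&& i <= s, s <= t, t <= j,
      uniqueb (substr T i j) (substr T s t) &
      proper_subs_repeating (substr T i j) (substr T s t)].

End Strings.

(* MUS(T[i..j]) as a finite set of intervals [s,t] of positions of T *)
Definition MUS (A : eqType) (T : seq A) (i j : nat) : {set 'I_(size T).+1 * 'I_(size T).+1} :=
  [set p : 'I_(size T).+1 * 'I_(size T).+1 | is_mus T i j p.1 p.2].

Definition symdiff (X : finType) (B C : {set X}) : {set X} := (B :\: C) :|: (C :\: B).

(* Main.v *)
(** Prepending a letter [x] to a window [S] raises by one the number of
    occurrences of the prefixes of [x :: S] and changes no other count.  A minimal
    unique word of [S] that is lost is therefore the shortest prefix of [x :: S]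
    that does not repeat in [S], so at most one is lost.  A gained word is either
    itself a prefix of [x :: S], or deleting its last or its first letter leaves a
    prefix of [x :: S] that occurs once in [S].  Each of these three kinds contains
    at most one word, and the existence of such a prefix forces a loss; hence
    gained <= 1 + 2 * lost.  The bounds are attained by the windows [c a^m c b b]
    and [a b a c^m a b]. *)
Require Import Defs.
From mathcomp Require Import all_boot all_order all_algebra.
From mathcomp Require Import zify.
Set Implicit Arguments. Unset Strict Implicit. Unset Printing Implicit Defensive.

#[local] Arguments occ : simpl never.

Definition butlast {T : Type} (w : seq T) : seq T := take (size w).-1 w.

Section ProperInfixes.
Variable A : eqType.
Implicit Types (s u w : seq A).

Definition prefix_comparable u w : bool := prefix u w || prefix w u.

Definition proper_infix u w : bool := infix u w && (u != w).

Lemma butlast_rcons w x : butlast (rcons w x) = w.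
Proof. by rewrite /butlast size_rcons -cats1 take_size_cat. Qed.

Lemma prefixes_comparable s u w : prefix u s -> prefix w s -> prefix_comparable u w.
Proof.
rewrite /prefix_comparable; elim: s u w => [|x s IHs] [|y u] [|z w] //=.
by case/andP=> /eqP-> us /andP[/eqP-> ws]; rewrite eqxx; exact: IHs.
Qed.

Lemma proper_infix_size u w : proper_infix u w = infix u w && (size u < size w).
Proof.
rewrite /proper_infix; case: (boolP (infix u w)) => //= uw.
rewrite ltn_neqAle (size_infix uw) andbT; congr (~~ _).
apply/eqP/eqP => [-> //|]; case/infixP: uw => p [q ->]; rewrite !size_cat.
by case: p q => [|y p] [|z q] /=; rewrite ?cats0 //; lia.
Qed.

Lemma proper_infixE u w : w != [::] ->
  proper_infix u w = infix u (behead w) || infix u (butlast w).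
Proof.
case/lastP: w => // w y _; rewrite butlast_rcons proper_infix_size size_rcons.
apply/andP/orP => [[/infixP[p [q wE]] uw]|[uw|uw]].
- case: p wE => [|z p] wE; last by left; rewrite wE; exact: infix_infix.
  case/lastP: q wE => [|q z] wE.
    by move: uw; rewrite -(size_rcons w y) wE cats0 ltnn.
  by right; move: wE; rewrite -rcons_cat => /rcons_inj[-> _]; exact: prefix_infix.
- split; first by apply: infix_trans uw _; case: w => //= z w; apply: infix_cons.
  by have := size_infix uw; rewrite size_behead size_rcons.
- by split; [apply: infix_trans uw (infix_rcons _ _) | rewrite ltnS size_infix].
Qed.

Lemma proper_infix_butlast w : w != [::] -> proper_infix (butlast w) w.
Proof. by move=> w0; rewrite proper_infixE // infix_refl orbT. Qed.

Lemma proper_infix_behead w : w != [::] -> proper_infix (behead w) w.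
Proof. by move=> w0; rewrite proper_infixE // infix_refl. Qed.

Lemma proper_infix_extend u w : proper_infix u w ->
  exists x, infix (x :: u) w \/ infix (rcons u x) w.
Proof.
case/andP=> /infixP[p [q ->]]; case/lastP: p q => [|p x] [|y q].
- by rewrite cats0 eqxx.
- by exists y; right; rewrite -cat_rcons; exact: prefix_infix.
all: by exists x; left; rewrite cat_rcons -cat_cons; exact: infix_infix.
Qed.

End ProperInfixes.

Section Occurrences.
Variable A : eqType.
Implicit Types (x y : A) (p q u v w s S : seq A).

Lemma occ_nil w : occ [::] w = (w == [::]).
Proof. by case: w. Qed.

Lemma occ_cons x S w : occ (x :: S) w = prefix w (x :: S) + occ S w.
Proof.
case: w => [//|y w]; rewrite prefixE /occ /= -[1]addn0 iotaDl count_map.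
by congr (_ + _); exact: eq_count.
Qed.

Lemma occ_letter S x : occ S [:: x] = count_mem x S.
Proof. by elim: S => // y S IHS; rewrite occ_cons IHS /= prefix0s andbT eq_sym. Qed.

Lemma occ_gt0 S w : (0 < occ S w) = infix w S.
Proof.
elim: S => [|x S IHS]; first by rewrite occ_nil infixs0 lt0b.
by rewrite occ_cons addn_gt0 lt0b IHS.
Qed.

Lemma leq_occ_cons2 x y S w : occ (x :: S) (y :: w) <= occ S w.
Proof.
elim: S x => [|z S IHS] x; rewrite occ_cons prefix_cons.
  by rewrite !occ_nil addn0 prefixs0; case: eqP; rewrite ?andbF ?leq_b1.
rewrite [leqRHS]occ_cons leq_add //.
by case: (prefix w _); rewrite ?andbF ?leq_b1.
Qed.

Lemma leq_occ_infix S u w : infix u w -> occ S w <= occ S u.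
Proof.
case/infixP=> p [q ->]; apply: (@leq_trans (occ S (u ++ q))).
  elim: p => //= y p IHp; apply: leq_trans IHp; case: S => [|x S] //.
  by apply: leq_trans (leq_occ_cons2 x y S _) _; rewrite occ_cons leq_addl.
elim: S => [|x S IHS]; first by rewrite !occ_nil; case: u => //; rewrite leq_b1.
rewrite !occ_cons leq_add //.
by have := @catl_prefix _ u (x :: S) q; do 2!case: prefix => // /(_ isT).
Qed.

Lemma occ_le1_cat_inj p q p' q' v : occ (p ++ v ++ q) v <= 1 ->
  p ++ v ++ q = p' ++ v ++ q' -> p = p'.
Proof.
have occ_v r r' : 0 < occ (r ++ v ++ r') v by rewrite occ_gt0 infix_infix.
elim: p p' => [|x p IHp] [|x' p'] //= occ1 eq_cat; move: (occ1).
- by rewrite eq_cat occ_cons -eq_cat prefix_prefix leqNgt ltnS occ_v.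
- by rewrite occ_cons eq_cat prefix_prefix leqNgt ltnS occ_v.
- case: eq_cat => <- eq_cat; rewrite occ_cons => /(leq_trans (leq_addl _ _)) occp1.
  by rewrite (IHp p').
Qed.

Lemma occ_le1_extend S v p q p' q' : occ S v <= 1 -> size p = size p' ->
    infix (p ++ v ++ q) S -> infix (p' ++ v ++ q') S ->
  prefix_comparable (p ++ v ++ q) (p' ++ v ++ q').
Proof.
move=> occ1 eq_size /infixP[r [s SE]] /infixP[r' [s' SE']].
have {}SE : S = (r ++ p) ++ v ++ q ++ s by rewrite SE -!catA.
have {}SE' : S = (r' ++ p') ++ v ++ q' ++ s' by rewrite SE' -!catA.
have eq_rp : r ++ p = r' ++ p'.
  by apply: occ_le1_cat_inj (etrans (esym SE) SE'); rewrite -SE.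
have eq_size_r : size r = size r'.
  by have := congr1 size eq_rp; rewrite !size_cat; lia.
have <- : p = p' by rewrite -[LHS](drop_size_cat _ eq_size_r) eq_rp drop_size_cat.
have eq_qs : q ++ s = q' ++ s'.
  by move/eqP: SE'; rewrite SE eq_rp eqseq_cat // eqxx eqseq_cat // eqxx => /eqP.
apply: (@prefixes_comparable _ (p ++ v ++ q ++ s)).
  by rewrite !catA prefix_prefix.
by rewrite eq_qs !catA prefix_prefix.
Qed.

End Occurrences.

Section MinimalUniqueWords.
Variable A : eqType.
Implicit Types (x y : A) (u v w S : seq A).

Definition mus S w : bool :=
  [&& w != [::], uniqueb S w & proper_subs_repeating S w].

Lemma proper_subs_repeatingP S w :
  reflect (forall u, proper_infix u w -> 1 < occ S u) (proper_subs_repeating S w).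
Proof.
apply: (iffP forallP) => [rep u|rep a].
  rewrite proper_infix_size => /andP[/infixP[p [q wE]] uw].
  have szw : size w = size p + size u + size q by rewrite wE !size_cat addnA.
  have uE : take (size u) (drop (size p) w) = u.
    by rewrite wE drop_size_cat // take_size_cat.
  have /forallP/(_ (inord (size p + size u)))/implyP := rep (inord (size p)).
  by rewrite !inordK ?addKn ?uE; [apply; lia | lia | lia].
apply/forallP=> b; apply/implyP=> /andP[ab bw]; apply: rep.
rewrite proper_infix_size (infix_trans (infix_take _ _) (infix_drop _ _)).
by rewrite (leq_ltn_trans _ bw) // size_take; case: ltnP.
Qed.

Lemma musP S w :
  reflect [/\ w != [::], occ S w = 1 & forall u, proper_infix u w -> 1 < occ S u]
          (mus S w).
Proof.
by apply: (iffP and3P) => -[w0 /eqP occ1 /proper_subs_repeatingP rep].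
Qed.

Lemma musE S w : mus S w =
  [&& w != [::], occ S w == 1, 1 < occ S (behead w) & 1 < occ S (butlast w)].
Proof.
apply/musP/and4P => [[w0 -> rep]|[w0 /eqP occ1 behead2 butlast2]].
  by rewrite !rep ?proper_infix_behead ?proper_infix_butlast.
split=> // u; rewrite proper_infixE //.
by case/orP=> /(leq_occ_infix S) => [/(leq_trans behead2)|/(leq_trans butlast2)].
Qed.

Lemma mus_pair S x y : mus S [:: x; y] =
  [&& occ S [:: x; y] == 1, 1 < count_mem x S & 1 < count_mem y S].
Proof. by rewrite musE /= !occ_letter [X in _ && X]andbC. Qed.

Lemma mus_infix_inj S u w : mus S u -> mus S w -> infix u w -> u = w.
Proof.
move=> /musP[_ occ1 _] /musP[_ _ rep] uw; apply/eqP/negPn/negP => neq_uw.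
by have := rep u; rewrite /proper_infix uw neq_uw occ1 => /(_ isT).
Qed.

Lemma mus_comparable_inj S u w :
  mus S u -> mus S w -> prefix_comparable u w -> u = w.
Proof.
move=> mus_u mus_w /orP[] /prefixW; first exact: (mus_infix_inj mus_u mus_w).
by move/(mus_infix_inj mus_w mus_u).
Qed.

Lemma mus_prefix_inj S v u w :
  mus S u -> mus S w -> prefix u v -> prefix w v -> u = w.
Proof.
move=> mus_u mus_w pre_u pre_w.
exact: (mus_comparable_inj mus_u mus_w (prefixes_comparable pre_u pre_w)).
Qed.

End MinimalUniqueWords.

Section PrependedLetter.
Variables (A : eqType) (x : A) (S : seq A).
Implicit Types (u v w : seq A).

Definition lost_word w : bool := mus S w && ~~ mus (x :: S) w.

Definition gained_word w : bool := mus (x :: S) w && ~~ mus S w.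

Definition becomes_repeating v : bool := prefix v (x :: S) && (occ S v == 1).

Definition grown_from (strip : seq A -> seq A) w : bool :=
  infix w S && becomes_repeating (strip w).

Lemma becomes_repeatingE v :
  becomes_repeating v = (occ S v <= 1) && (1 < occ (x :: S) v).
Proof. by rewrite /becomes_repeating occ_cons; case: prefix; lia. Qed.

Lemma lost_wordE w : lost_word w = mus S w && prefix w (x :: S).
Proof.
rewrite /lost_word; case: musP => // -[w0 occ1 rep]; rewrite !andTb.
apply/idP/idP => [|pre]; last first.
  by apply/musP => -[_]; rewrite occ_cons pre occ1.
apply: contraR => npre; apply/musP; split=> // [|u /rep].
  by rewrite occ_cons (negbTE npre).
by rewrite occ_cons => /leq_trans-> //; rewrite leq_addl.
Qed.

Lemma lost_word_least w v :
  lost_word w -> prefix v (x :: S) -> occ S v <= 1 -> prefix w v.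
Proof.
rewrite lost_wordE => /andP[/musP[_ _ rep] pre_w] pre_v occ_v.
case/orP: (prefixes_comparable pre_w pre_v) => // vw.
have [-> | neq_vw] := eqVneq v w; first exact: prefix_refl.
by have := rep v; rewrite /proper_infix (prefixW vw) neq_vw ltnNge occ_v => /(_ isT).
Qed.

Lemma lost_word_unique u w : lost_word u -> lost_word w -> u = w.
Proof.
move=> lost_u lost_w; have [/andP[mus_u _] /andP[mus_w _]] := (lost_u, lost_w).
apply: (mus_comparable_inj mus_u mus_w).
rewrite /prefix_comparable (lost_word_least lost_u) //.
  by move: lost_w; rewrite lost_wordE => /andP[].
by case/musP: mus_w => _ ->.
Qed.

(* Besides the occurrence that [w] forces in [S] behind its first letter, its
   tail also occurs at the start of [S]. *)
Lemma repeating_behead w : w != [::] -> prefix w (x :: S) -> 0 < occ S w ->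
  1 < occ S (behead w).
Proof.
case: w => // y u _; rewrite prefix_cons => /andP[_].
case: S => [|z S'] // pre_u occ_w; rewrite occ_cons pre_u ltnS.
exact: leq_trans (leq_occ_cons2 z y S' u).
Qed.

Lemma lost_word_exists v :
  0 < size S -> becomes_repeating v -> exists w, lost_word w.
Proof.
move=> S_gt0 /andP[pre_v /eqP occ_v].
have vE : take (size v) (x :: S) = v by apply/eqP; rewrite -prefixE.
have ex_rare : exists k, occ S (take k (x :: S)) <= 1.
  by exists (size v); rewrite vE occ_v.
case: (ex_minnP ex_rare) => k rare kmin; exists (take k (x :: S)).
have k_le : k <= size v by apply: kmin; rewrite vE occ_v.
have size_k : size (take k (x :: S)) = k.
  by rewrite size_takel // (leq_trans k_le) // size_prefix.
have k_gt0 : 0 < k by case: (k) rare; rewrite ?take0 // ltnS leqNgt S_gt0.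
have occ1 : occ S (take k (x :: S)) = 1.
  have : prefix (take k (x :: S)) v by rewrite prefixE size_k -{1}vE take_takel.
  by move=> /prefixW/(leq_occ_infix S); rewrite occ_v; lia.
have w0 : take k (x :: S) != [::] by rewrite -size_eq0 size_k -lt0n.
rewrite lost_wordE prefix_take andbT musE occ1 w0.
rewrite repeating_behead ?prefix_take ?occ1 //.
rewrite /butlast size_k take_takel ?leq_pred // ltnNge; apply/negP => /kmin.
by rewrite leqNgt ltn_predL k_gt0.
Qed.

Lemma gained_wordP w : gained_word w ->
  [|| prefix w (x :: S), grown_from butlast w | grown_from behead w].
Proof.
rewrite /gained_word !musE; case/andP=> /and4P[w0 occ1 behead2 butlast2].
rewrite w0 /grown_from -occ_gt0 !becomes_repeatingE behead2 butlast2 !andbT.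
rewrite !negb_and -!leqNgt.
move: occ1; rewrite occ_cons; case: prefix => //; rewrite add0n => /eqP->.
by rewrite /= orbC.
Qed.

Lemma gained_word_contains_lost u w :
  lost_word u -> gained_word w -> proper_infix u w.
Proof.
move=> lost_u gained_w; rewrite /proper_infix andbC; apply/andP; split.
  apply: contraTneq lost_u => ->; case/andP: gained_w => mus_w _.
  by rewrite /lost_word mus_w andbF.
have infix_u v : becomes_repeating v -> infix u v.
  case/andP=> pre_v /eqP occ_v.
  by apply/prefixW/(lost_word_least lost_u) => //; rewrite occ_v.
have w0 : w != [::] by case/andP: gained_w => /musP[].
case/or3P: (gained_wordP gained_w) => [pre_w|/andP[_ /infix_u]|/andP[_ /infix_u]].
- apply/prefixW/(lost_word_least lost_u) => //.
  case/andP: gained_w => /musP[_ + _ _]; rewrite occ_cons pre_w; lia.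
- by move/infix_trans; apply; case/andP: (proper_infix_butlast w0).
- by move/infix_trans; apply; case/andP: (proper_infix_behead w0).
Qed.

(* A word that occurs once in [S] fixes where its extensions lie in [S], and
   minimal unique words that start at the same place are equal. *)
Lemma mus_extension_inj p v q p' v' q' : size p = size p' ->
    becomes_repeating v -> becomes_repeating v' ->
    mus (x :: S) (p ++ v ++ q) -> mus (x :: S) (p' ++ v' ++ q') ->
    infix (p ++ v ++ q) S -> infix (p' ++ v' ++ q') S ->
  p ++ v ++ q = p' ++ v' ++ q'.
Proof.
wlog vv' : p v q p' v' q' / prefix v v' => [wlog_vv'|] eq_size rep_v rep_v'.
  have [/andP[pre_v _] /andP[pre_v' _]] := (rep_v, rep_v').
  move=> mus_v mus_v' in_v in_v'.
  case/orP: (prefixes_comparable pre_v pre_v') => [vv'|v'v]; first exact: wlog_vv'.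
  by symmetry; exact: wlog_vv'.
move=> mus_v mus_v' in_v; case/prefixP: vv' mus_v' => r ->.
rewrite -catA => mus_v' in_v'.
apply: (mus_comparable_inj mus_v mus_v'); apply: occ_le1_extend in_v in_v' => //.
by case/andP: rep_v => _ /eqP->.
Qed.

Lemma mus_grown_butlast_inj u w : mus (x :: S) u -> mus (x :: S) w ->
  grown_from butlast u -> grown_from butlast w -> u = w.
Proof.
case/lastP: u => [/musP[] //|u y]; case/lastP: w => [_ /musP[] //|w z].
rewrite /grown_from !butlast_rcons -!cats1.
move=> mus_u mus_w /andP[in_u rep_u] /andP[in_w rep_w].
exact: (@mus_extension_inj [::] u [:: y] [::] w [:: z]).
Qed.

Lemma mus_grown_behead_inj u w : mus (x :: S) u -> mus (x :: S) w ->
  grown_from behead u -> grown_from behead w -> u = w.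
Proof.
case: u => [/musP[] //|y u]; case: w => [_ /musP[] //|z w].
move=> mus_u mus_w /andP[in_u rep_u] /andP[in_w rep_w].
by have := @mus_extension_inj [:: y] u [::] [:: z] w [::]; rewrite /= !cats0; apply.
Qed.

End PrependedLetter.

Section Intervals.
Variables (A : eqType) (T : seq A).
Implicit Types (s t i j : nat) (p : 'I_(size T).+1 * 'I_(size T).+1).

Definition factor p : seq A := substr T p.1 p.2.

Lemma size_substr s t : 0 < s -> t <= size T -> size (substr T s t) = t.+1 - s.
Proof.
by move=> s_gt0 tT; rewrite /substr size_take size_drop; case: ltnP; lia.
Qed.

Lemma substr_catE i k j : 0 < i -> i <= k.+1 -> k <= j ->
  substr T i j = substr T i k ++ substr T k.+1 j.
Proof.
move=> i_gt0 ik kj; rewrite /substr.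
have -> : j.+1 - i = (k.+1 - i) + (j.+1 - k.+1) by lia.
by rewrite takeD drop_drop; congr (_ ++ take _ (drop _ _)); lia.
Qed.

Lemma behead_substr i j : 0 < i -> behead (substr T i j) = substr T i.+1 j.
Proof.
move=> i_gt0; rewrite /substr subSS -drop1.
have [ij|ji] := leqP i j; last by rewrite (eqP ji) (eqP (ltnW ji)) !take0.
by rewrite subSn // -[(j - i).+1]addn1 -take_drop drop_drop add1n prednK.
Qed.

Lemma substr_split i j s t : 0 < i -> i <= s -> s <= t -> t <= j ->
  substr T i j = substr T i s.-1 ++ substr T s t ++ substr T t.+1 j.
Proof.
move=> i_gt0 le_is le_st le_tj; rewrite (@substr_catE i s.-1 j); [|lia|lia|lia].
by rewrite prednK ?(@substr_catE s t j) //; lia.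
Qed.

Lemma infix_substrP i j w :
    0 < i -> j <= size T -> w != [::] -> infix w (substr T i j) ->
  exists s t, [/\ i <= s, s <= t, t <= j & substr T s t = w].
Proof.
move=> i_gt0 jT w0 /infixP[p [q windowE]].
have [size_w size_window] : 0 < size w /\ j.+1 - i = (size w + size q) + size p.
  by rewrite lt0n size_eq0 w0 -(size_substr i_gt0 jT) windowE !size_cat addnC.
exists (i + size p), (i + size p + (size w).-1); split; try lia.
have := congr1 (fun v => take (size w) (drop (size p) v)) windowE.
rewrite drop_size_cat // take_size_cat // => wE; rewrite -[RHS]wE /substr size_window.
rewrite -take_drop drop_drop take_takel ?leq_addr //.
by congr (take _ (drop _ _)); lia.
Qed.

Lemma substr_inj i j s t s' t' : 0 < i -> j <= size T ->
    i <= s -> s <= t -> t <= j -> i <= s' -> s' <= t' -> t' <= j ->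
    occ (substr T i j) (substr T s t) <= 1 -> substr T s t = substr T s' t' ->
  s = s' /\ t = t'.
Proof.
move=> i_gt0 jT le_is le_st le_tj le_is' le_st' le_tj' occ1 eq_sub.
have eq_size := congr1 size eq_sub; rewrite !size_substr in eq_size; try lia.
have splitE := substr_split i_gt0 le_is le_st le_tj.
have splitE' := substr_split i_gt0 le_is' le_st' le_tj'; rewrite -eq_sub in splitE'.
rewrite {1}splitE in occ1.
have := congr1 size (occ_le1_cat_inj occ1 (etrans (esym splitE) splitE')).
by rewrite !size_substr; lia.
Qed.

Lemma in_MUS i j p : 0 < i -> j <= size T ->
  (p \in MUS T i j) =
  [&& i <= p.1, p.1 <= p.2, p.2 <= j & mus (substr T i j) (factor p)].
Proof.
move=> i_gt0 jT; rewrite inE /is_mus /mus -size_eq0.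
case: leqP => //= ip; case: leqP => //= p12; case: leqP => //= pj.
by rewrite size_substr //; [case: eqP => //; lia | lia | lia].
Qed.

Lemma factor_inj i j : 0 < i -> j <= size T -> {in MUS T i j &, injective factor}.
Proof.
move=> i_gt0 jT [s t] [s' t']; rewrite !in_MUS //= /factor /=.
case/and4P=> le_is le_st le_tj /musP[_ occ1 _].
case/and4P=> le_is' le_st' le_tj' _ eq_sub.
have [|] := substr_inj i_gt0 jT le_is le_st le_tj le_is' le_st' le_tj' _ eq_sub.
  by rewrite occ1.
by move=> /val_inj-> /val_inj->.
Qed.

Lemma factor_surj i j w : 0 < i -> j <= size T -> mus (substr T i j) w ->
  exists2 p, p \in MUS T i j & factor p = w.
Proof.
move=> i_gt0 jT mus_w; have /musP[w0 occ1 _] := mus_w.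
have [|s [t [le_is le_st le_tj eq_w]]] := infix_substrP i_gt0 jT w0.
  by rewrite -occ_gt0 occ1.
exists (inord s, inord t); rewrite ?in_MUS /factor //= !inordK ?eq_w ?le_is //.
all: lia.
Qed.

Definition lost_MUS i j : {set 'I_(size T).+1 * 'I_(size T).+1} :=
  MUS T i.+1 j :\: MUS T i j.

Definition gained_MUS i j : {set 'I_(size T).+1 * 'I_(size T).+1} :=
  MUS T i j :\: MUS T i.+1 j.

End Intervals.

Section ExtendedWindow.
Variables (A : eqType) (T : seq A) (i j : nat) (x : A) (S : seq A).
Hypotheses (i_gt0 : 0 < i) (jT : j <= size T) (windowE : substr T i j = x :: S).
Implicit Type (p : 'I_(size T).+1 * 'I_(size T).+1).

Lemma shorter_windowE : substr T i.+1 j = S.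
Proof. by rewrite -behead_substr // windowE. Qed.

Lemma in_MUS_shorter p : p \in MUS T i j -> (p \in MUS T i.+1 j) = mus S (factor p).
Proof.
rewrite !in_MUS // windowE shorter_windowE => /and4P[ip p12 pj /musP[_ occ1 _]].
rewrite p12 pj; case: ltngtP ip => // ip _; apply/esym/negP => /musP[_ occS _].
have pre_p : prefix (factor p) (x :: S).
  by rewrite -windowE /factor -ip (@substr_catE _ T i p.2 j) ?prefix_prefix //; lia.
by move: occ1; rewrite occ_cons pre_p occS.
Qed.

Lemma in_MUS_longer p :
  p \in MUS T i.+1 j -> (p \in MUS T i j) = mus (x :: S) (factor p).
Proof. by rewrite !in_MUS // windowE => /and4P[/ltnW-> -> ->]. Qed.

Lemma factor_gained p : p \in gained_MUS T i j -> gained_word x S (factor p).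
Proof.
case/setDP=> Mp; rewrite in_MUS_shorter // /gained_word => ->.
by move: Mp; rewrite in_MUS // windowE => /and4P[_ _ _ ->].
Qed.

Lemma factor_lost p : p \in lost_MUS T i j -> lost_word x S (factor p).
Proof.
case/setDP=> Mp; rewrite in_MUS_longer // /lost_word => ->.
by move: Mp; rewrite in_MUS // shorter_windowE => /and4P[_ _ _ ->].
Qed.

Lemma factor_gained_surj w : gained_word x S w ->
  exists2 p, p \in gained_MUS T i j & factor p = w.
Proof.
case/andP; rewrite -windowE => /factor_surj[] // p Mp <- nmus.
by exists p; rewrite // in_setD Mp in_MUS_shorter ?nmus.
Qed.

Lemma factor_lost_surj w : lost_word x S w ->
  exists2 p, p \in lost_MUS T i j & factor p = w.
Proof.
case/andP; rewrite -{1}shorter_windowE => /factor_surj[] // p Mp <- nmus.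
by exists p; rewrite // in_setD Mp in_MUS_longer ?nmus.
Qed.

Lemma card_lost_le1 : #|lost_MUS T i j| <= 1.
Proof.
apply/card_le1_eqP => p q lost_p lost_q.
have [/setDP[Mp _] /setDP[Mq _]] := (lost_p, lost_q).
apply: (@factor_inj _ T i.+1 j) => //.
exact: lost_word_unique (factor_lost lost_q) (factor_lost lost_p).
Qed.

Lemma leq_card_gained (ws : seq (seq A)) : uniq ws -> all (gained_word x S) ws ->
  size ws <= #|gained_MUS T i j|.
Proof.
move=> uniq_ws /allP gained_ws; rewrite -(size_image (@factor A T)).
apply: uniq_leq_size => // w /gained_ws /factor_gained_surj[p Gp <-].
exact: image_f.
Qed.

Hypothesis S_gt0 : 0 < size S.

Lemma card_lost_gt0 v : becomes_repeating x S v -> 0 < #|lost_MUS T i j|.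
Proof.
move=> /(lost_word_exists S_gt0)[w /factor_lost_surj[p lost_p _]].
by apply/card_gt0P; exists p.
Qed.

Definition MUS_with (P : pred (seq A)) : {set 'I_(size T).+1 * 'I_(size T).+1} :=
  [set p in MUS T i j | P (factor p)].

Lemma card_MUS_with_le1 (P : pred (seq A)) :
    (forall u w, mus (x :: S) u -> mus (x :: S) w -> P u -> P w -> u = w) ->
  #|MUS_with P| <= 1.
Proof.
move=> P_inj; apply/card_le1_eqP => p q /setIdP[Mp Pp] /setIdP[Mq Pq].
have mus_M r : r \in MUS T i j -> mus (x :: S) (factor r).
  by rewrite in_MUS // windowE => /and4P[].
by apply: (@factor_inj _ T i j) => //; apply: P_inj Pq Pp; exact: mus_M.
Qed.

Lemma gained_sub :
  gained_MUS T i j \subset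
    MUS_with [pred w | prefix w (x :: S)] :|:
    (MUS_with (grown_from x S butlast) :|: MUS_with (grown_from x S behead)).
Proof.
apply/subsetP => p gained_p; have [Mp _] := setDP gained_p.
have with_P P : (p \in MUS_with P) = P (factor p) by apply/setIdP/idP => [[]|].
by rewrite !in_setU !with_P; exact: gained_wordP (factor_gained gained_p).
Qed.

Lemma card_grown_le strip :
    (forall u w, mus (x :: S) u -> mus (x :: S) w ->
      grown_from x S strip u -> grown_from x S strip w -> u = w) ->
  #|MUS_with (grown_from x S strip)| <= #|lost_MUS T i j|.
Proof.
move=> grown_inj; have [->|[p]] := set_0Vmem (MUS_with (grown_from x S strip)).
  by rewrite cards0.
case/setIdP=> _ /andP[_ /card_lost_gt0]; apply: leq_trans.
exact: card_MUS_with_le1.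
Qed.

Lemma card_gained_le : #|gained_MUS T i j| <= 1 + 2 * #|lost_MUS T i j|.
Proof.
apply: leq_trans (subset_leq_card gained_sub) _.
apply: leq_trans (leq_card_setU _ _) _; apply: leq_add.
  by apply: card_MUS_with_le1 => u w; exact: mus_prefix_inj.
apply: leq_trans (leq_card_setU _ _) _; rewrite mul2n -addnn.
apply: leq_add; apply: card_grown_le; first exact: mus_grown_butlast_inj.
exact: mus_grown_behead_inj.
Qed.

End ExtendedWindow.

Lemma card_symdiff (X : finType) (B C : {set X}) :
  #|symdiff B C| = #|B :\: C| + #|C :\: B|.
Proof.
rewrite /symdiff cardsU; suff -> : (B :\: C) :&: (C :\: B) = set0.
  by rewrite cards0 subn0.
by apply/setP => x; rewrite !inE; case: (x \in B); case: (x \in C).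
Qed.

Lemma card_subE (X : finType) (B C : {set X}) :
  (#|B|%:Z - #|C|%:Z = #|B :\: C|%:Z - #|C :\: B|%:Z)%R.
Proof. by have := cardsID C B; have := cardsID B C; rewrite setIC; lia. Qed.

Section PrependedPosition.
Variables (A : eqType) (T : seq A) (i j : nat).
Hypotheses (i_gt0 : 0 < i) (ij : i < j) (jT : j <= size T).

Lemma card_lost_gained :
  #|lost_MUS T i j| <= 1 /\ #|gained_MUS T i j| <= 1 + 2 * #|lost_MUS T i j|.
Proof.
have := size_substr i_gt0 jT; case windowE: (substr T i j) => [|x S] /= size_S.
  by lia.
split; first exact: card_lost_le1 windowE.
by apply: card_gained_le windowE _; lia.
Qed.

Lemma MUS_prepend_bounds :
  #|symdiff (MUS T i j) (MUS T i.+1 j)| <= 4 /\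
  (-1 <= #|MUS T i j|%:Z - #|MUS T i.+1 j|%:Z <= 2)%R.
Proof.
have := card_lost_gained; rewrite card_symdiff card_subE.
by rewrite -/(lost_MUS T i j) -/(gained_MUS T i j); lia.
Qed.

Lemma MUS_three_gained : 3 <= #|gained_MUS T i j| ->
  #|symdiff (MUS T i j) (MUS T i.+1 j)| = 4 /\
  (#|MUS T i j|%:Z - #|MUS T i.+1 j|%:Z = 2)%R.
Proof.
have := card_lost_gained; rewrite card_symdiff card_subE.
by rewrite -/(lost_MUS T i j) -/(gained_MUS T i j); lia.
Qed.

Lemma MUS_only_lost : gained_MUS T i j = set0 -> 0 < #|lost_MUS T i j| ->
  (#|MUS T i j|%:Z - #|MUS T i.+1 j|%:Z = -1)%R.
Proof.
have := card_lost_gained; rewrite card_subE -/(lost_MUS T i j) -/(gained_MUS T i j).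
by move=> [lost1 _] ->; rewrite cards0; lia.
Qed.

End PrependedPosition.

Lemma string_with_window (A : eqType) (x0 : A) (w : seq A) (n i j : nat) :
    0 < i -> j.+1 = i + size w -> j <= n ->
  exists2 T : seq A, size T = n & substr T i j = w.
Proof.
move=> i_gt0 jE jn; exists (nseq i.-1 x0 ++ w ++ nseq (n - j) x0).
  by rewrite !size_cat !size_nseq; lia.
by rewrite /substr drop_size_cat ?size_nseq // take_size_cat // jE addKn.
Qed.

Lemma occ_nseq_cat_pair (A : eqType) m (a x y : A) s :
  occ (nseq m.+1 a ++ s) [:: x; y] =
  m * ((x == a) && (y == a)) + occ (a :: s) [:: x; y].
Proof.
elim: m => [//|m IHm]; rewrite [nseq _ _ ++ s]/= occ_cons -cat_cons IHm mulSn addnA.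
by congr (_ + _ + _); rewrite !prefix_cons prefix0s andbT.
Qed.

Section Tightness.
Variables (A : eqType) (a b c : A) (m : nat).
Hypotheses (ab : a != b) (bc : b != c) (ca : c != a).

Let ba : b != a. Proof. by rewrite eq_sym. Qed.
Let cb : c != b. Proof. by rewrite eq_sym. Qed.
Let ac : a != c. Proof. by rewrite eq_sym. Qed.
Let letterE :=
  (eqxx, negbTE ab, negbTE bc, negbTE ca, negbTE ba, negbTE cb, negbTE ac).

Definition gaining_suffix : seq A := nseq m.+2 a ++ [:: c; b; b].

Definition gained_words : seq (seq A) := [:: [:: c; a]; [:: a; c]; [:: c; b]].

Lemma uniq_gained_words : uniq gained_words.
Proof. by rewrite /= !inE !eqseq_cons !letterE. Qed.

Definition losing_suffix : seq A := [:: b, a & nseq m.+1 c ++ [:: a; b]].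

Lemma occ_gaining_pair x y : occ gaining_suffix [:: x; y] =
  m.+1 * ((x == a) && (y == a)) + ((x == a) && (y == c)) +
  ((x == c) && (y == b)) + ((x == b) && (y == b)).
Proof.
rewrite occ_nseq_cat_pair !occ_cons occ_nil.
rewrite !prefix_cons !prefix0s !prefixs0 !andbT !andbF.
by rewrite /= !addn0 !addnA.
Qed.

Lemma gaining_suffix_gains : all (gained_word c gaining_suffix) gained_words.
Proof.
have countE x :
    count_mem x gaining_suffix = (a == x) * m.+2 + (c == x) + 2 * (b == x).
  by rewrite count_cat count_nseq /= addn0 mul2n -addnn addnA.
have count_consE x :
    count_mem x (c :: gaining_suffix) = (c == x) + count_mem x gaining_suffix by [].
rewrite /gained_words /all /gained_word !mus_pair !(occ_cons c gaining_suffix).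
rewrite !occ_gaining_pair !prefix_cons !count_consE !countE.
by rewrite !letterE /= !(muln0, muln1).
Qed.

Lemma occ_losing_pair x y : occ losing_suffix [:: x; y] =
  ((x == b) && (y == a)) + ((x == a) && (y == c)) + m * ((x == c) && (y == c)) +
  ((x == c) && (y == a)) + ((x == a) && (y == b)).
Proof.
rewrite 2!occ_cons occ_nseq_cat_pair !occ_cons occ_nil.
rewrite !prefix_cons !prefix0s !prefixs0 !andbT !andbF.
by rewrite /= !addn0 !addnA.
Qed.

Lemma losing_suffix_loses : lost_word a losing_suffix [:: a; b].
Proof.
rewrite lost_wordE mus_pair occ_losing_pair /= !count_cat !count_nseq /=.
by rewrite !letterE /= !(muln0, muln1).
Qed.

(* A gained word would contain [a b] and one more letter, hence some [y a] or
   [b y] properly; but these pairs do not repeat. *)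
Lemma losing_suffix_gains_nothing w : ~~ gained_word a losing_suffix w.
Proof.
apply/negP => gained_w; have /andP[/musP[_ _ rep] _] := gained_w.
have occ_ya y : occ (a :: losing_suffix) [:: y; a] <= 1.
  rewrite (occ_cons a losing_suffix) occ_losing_pair /= !letterE.
  rewrite !andbF muln0 !addn0 !andbT.
  by have [-> | _] := eqVneq y b; rewrite ?letterE // leq_b1.
have occ_by y : occ (a :: losing_suffix) [:: b; y] <= 1.
  rewrite (occ_cons a losing_suffix) occ_losing_pair /= !letterE muln0 !addn0.
  exact: leq_b1.
have proper y1 y2 y3 : infix [:: y1; y2; y3] w ->
    proper_infix [:: y1; y2] w /\ proper_infix [:: y2; y3] w.
  move=> in_w; have lt2w : 2 < size w := size_infix in_w.
  rewrite !proper_infix_size lt2w (consl_infix in_w) !andbT.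
  by rewrite (infix_trans (prefix_infix [:: y1; y2] [:: y3])).
have [y [/proper[/rep + _]|/proper[_ /rep]]] :=
  proper_infix_extend (gained_word_contains_lost losing_suffix_loses gained_w).
- by rewrite ltnNge occ_ya.
- by rewrite ltnNge occ_by.
Qed.

End Tightness.

Section TightStrings.
Variables (A : eqType) (a b c : A) (n i j : nat).
Hypotheses (ab : a != b) (bc : b != c) (ca : c != a).
Hypotheses (i_gt0 : 0 < i) (ij : i + 5 <= j) (jn : j <= n).

Lemma three_gained_string :
  exists2 T : seq A, size T = n & 3 <= #|gained_MUS T i j|.
Proof.
pose S := gaining_suffix a b c (j - i - 5).
have jE : j.+1 = i + size (c :: S) by rewrite /= size_cat size_nseq /=; lia.
have [T szT windowE] := string_with_window c i_gt0 jE jn.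
have jT : j <= size T by rewrite szT.
exists T => //.
exact: (leq_card_gained i_gt0 jT windowE (uniq_gained_words ab bc ca)
                        (gaining_suffix_gains _ ab bc ca)).
Qed.

Lemma lost_only_string :
  exists T : seq A,
    [/\ size T = n, gained_MUS T i j = set0 & 0 < #|lost_MUS T i j|].
Proof.
pose S := losing_suffix a b c (j - i - 5).
have jE : j.+1 = i + size (a :: S) by rewrite /= size_cat size_nseq /=; lia.
have [T szT windowE] := string_with_window a i_gt0 jE jn.
have jT : j <= size T by rewrite szT.
exists T; split=> //.
  apply/setP => p; rewrite [RHS]in_set0; apply/negP.
  move/(factor_gained i_gt0 jT windowE).
  exact/negP/losing_suffix_gains_nothing.
have [p lost_p _] :=
  factor_lost_surj i_gt0 jT windowE (losing_suffix_loses _ ab bc ca).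
by apply/card_gt0P; exists p.
Qed.

End TightStrings.

Theorem theorem2 :
  (forall (Sigma : finType), 2 <= #|Sigma| ->
   forall (T : seq Sigma) (i j : nat), 1 < i -> i <= j -> j <= size T ->
     #|symdiff (MUS T i.-1 j) (MUS T i j)| <= 4 /\
     (-1 <= (#|MUS T i.-1 j|%:Z - #|MUS T i j|%:Z) <= 2)%R)
  /\
  (forall (Sigma : finType), 3 <= #|Sigma| ->
   forall (n i j : nat), 1 < i -> i <= j -> j <= n -> 5 <= j - i + 1 ->
     (exists T : seq Sigma, size T = n /\ #|symdiff (MUS T i.-1 j) (MUS T i j)| = 4) /\
     (exists T : seq Sigma, size T = n /\
        (#|MUS T i.-1 j|%:Z - #|MUS T i j|%:Z = 2)%R) /\
     (exists T : seq Sigma, size T = n /\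
        (#|MUS T i.-1 j|%:Z - #|MUS T i j|%:Z = -1)%R)).
Proof.
split=> [Sigma _ T [//|i] j i_gt1 ij jT|Sigma]; first exact: MUS_prepend_bounds.
move=> /card_gt2P[a [b [c [_ [ab bc ca]]]]] n [//|i] j i_gt0 ij jn len5.
have i5j : i + 5 <= j by lia.
have [T szT gain3] := three_gained_string ab bc ca i_gt0 i5j jn.
have [T' [szT' gain0 lost1]] := lost_only_string ab bc ca i_gt0 i5j jn.
have [|symdiff4 diff2] := MUS_three_gained i_gt0 ij _ gain3; first by rewrite szT.
split; [by exists T | split; [by exists T | exists T'; split=> //]].
by apply: MUS_only_lost gain0 lost1; rewrite ?szT'.
Qed.
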